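(* For every positive integer $k$ there exists a finite simple graph $G$ such that $\eta(G) \leq k \leq \eta_{\ell}(G)/2$.
   Context: All graphs are finite, simple and undirected. For a vertex $v$, $N(v)$ denotes its set of neighbours. An additive labeling of a graph $G$ is a function $\ell: V(G) \to \mathbb{N}$ (positive integers) such that for every two adjacent vertices $u,v$ of $G$, $\sum_{w \in N(v)} \ell(w) \neq \sum_{w \in N(u)} \ell(w)$. The additive number $\eta(G)$ is the minimum $k$ such that $G$ has an additive labeling $\ell: V(G) \to \{1,\dots,k\}$. The additive choosability number $\eta_{\ell}(G)$ is the smallest $k$ such that for every assignment $L$ of lists $L(v)$ of $k$ positive integers to the vertices $v$ of $G$, there is an additive labeling $\ell$ of $G$ with $\ell(v) \in L(v)$ for all $v$. *)

(* Defs.v *)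
From mathcomp Require Import all_boot all_order all_algebra.
From mathcomp Require Import boolp.

Set Implicit Arguments.
Unset Strict Implicit.
Unset Printing Implicit Defensive.

Record sgraph := SGraph {
  vertex :> finType;
  edge : rel vertex;
  edge_sym : symmetric edge;
  edge_irrefl : irreflexive edge }.

Definition neighbors (G : sgraph) (v : G) : {set G} := [set w | edge v w].

Definition additive_labeling (G : sgraph) (l : G -> nat) : Prop :=
  (forall v, 0 < l v) /\
  forall u v : G, edge u v ->
    \sum_(w in neighbors v) l w <> \sum_(w in neighbors u) l w.

Definition additively_labelable (G : sgraph) (k : nat) : Prop :=
  exists2 l : G -> nat, additive_labeling l & forall v, 1 <= l v <= k.

(* A list of k positive integers is a set of k of them, hence the [uniq]. *)
Definition list_assignment (G : sgraph) (k : nat) (L : G -> seq nat) : Prop :=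
  forall v, [/\ uniq (L v), size (L v) = k & all (leq 1) (L v)].

Definition additively_choosable (G : sgraph) (k : nat) : Prop :=
  forall L : G -> seq nat, list_assignment k L ->
    exists2 l : G -> nat, additive_labeling l & forall v, l v \in L v.

(* Vertices are labeled one at a time. When the label of x is chosen, each
   ordered pair (u, v) with x adjacent to exactly one of u and v forbids at
   most one value, so lists of more than #|G|^2 labels suffice. *)
Lemma greedy_labeling (G : sgraph) (L : G -> seq nat) (s : seq G) :
    (forall v, uniq (L v) /\ #|{: G * G}| < size (L v)) -> uniq s ->
  exists2 l : G -> nat, forall v, l v \in L v &
    forall u v, has (fun w => edge u w != edge v w) s ->
      \sum_(w <- s | edge u w) l w <> \sum_(w <- s | edge v w) l w.
Proof.
move=> hL; elim: s => [_|x s IHs /andP[xs /IHs [l lL lP]]].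
  exists (fun v => nth 0 (L v) 0) => // v.
  by apply: mem_nth; case: (hL v) => _; apply: leq_ltn_trans.
pose S u := \sum_(w <- s | edge u w) l w.
pose F := [seq S p.2 - S p.1 | p : G * G].
have [a aL aF] : exists2 a, a \in L x & a \notin F.
  apply/hasP; rewrite has_predC; apply/negP => /allP LF.
  have [uL] := hL x; apply/negP; rewrite -leqNgt.
  by rewrite -(size_image (fun p : G * G => S p.2 - S p.1)) uniq_leq_size.
have aFP u v : S u + a <> S v.
  move=> E; case/negP: aF; have -> : a = S v - S u by rewrite -E addKn.
  by apply/mapP; exists (u, v); rewrite ?mem_enum.
pose l' v := if v == x then a else l v.
have SE u : \sum_(w <- s | edge u w) l' w = S u.
  rewrite /S big_seq_cond [RHS]big_seq_cond; apply: eq_bigr => w /andP[ws _].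
  by rewrite /l'; case: eqP => // wx; rewrite -wx ws in xs.
exists l' => [v|u v /=]; first by rewrite /l'; case: eqP => [->|_].
rewrite !big_cons !SE.
case: (edge u x); case: (edge v x) => /= H.
- by move/addnI; apply: lP.
- by rewrite addnC {1}/l' eqxx; apply: aFP.
- by move/esym; rewrite [l' x + _]addnC {1}/l' eqxx; apply: aFP.
- exact: lP.
Qed.

Lemma additively_choosable_ex (G : sgraph) :
  exists k, `[< additively_choosable G k >].
Proof.
exists #|{: G * G}|.+1; apply/asboolP => L hL.
have hL' v : uniq (L v) /\ #|{: G * G}| < size (L v).
  by have [? -> _] := hL v.
have [l lL lP] := greedy_labeling hL' (enum_uniq G).
exists l => //; split=> [v|u v uv].
  by have [_ _ /allP] := hL v; apply.
have nE u' : \sum_(w in neighbors u') l w = \sum_(w <- enum G | edge u' w) l w.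
  by rewrite [RHS]big_enum_cond; apply: eq_bigl => w; rewrite inE.
rewrite !nE; apply: lP; apply/hasP; exists u; first by rewrite mem_enum.
by rewrite edge_sym uv edge_irrefl.
Qed.

Lemma additively_labelable_ex (G : sgraph) :
  exists k, `[< additively_labelable G k >].
Proof.
have [k /asboolP Gk] := additively_choosable_ex G.
exists k; apply/asboolP.
have [|l lP lL] := Gk (fun=> iota 1 k).
  move=> v; split; rewrite ?iota_uniq ?size_iota //.
  by apply/allP => i; rewrite mem_iota => /andP[].
by exists l => // v; have := lL v; rewrite mem_iota add1n ltnS.
Qed.

Definition additive_number (G : sgraph) : nat :=
  ex_minn (additively_labelable_ex G).

Definition additive_choosability (G : sgraph) : nat :=
  ex_minn (additively_choosable_ex G).

(* Main.v *)
Require Import Defs.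
From mathcomp Require Import all_boot all_order all_algebra.
From mathcomp Require Import boolp zify.

(** Take 2k - 1 cliques of order 2k and a hub x joined to one half of each of
them. Inside a clique the neighbour sums are distinct iff the values
l(w) - [w ~ x] l(x) are. With labels 1..k and l(x) = k, these can be made to
fill the 2k values 1-k..k. With lists of size m < 2k, let x have list {1..m},
and in the j-th clique let the vertices adjacent to x have list {j+1..j+m} and
the others {1..m}: when l(x) = j, the 2k values of the j-th clique lie in
{1..m}, so two of them coincide. *)

Lemma big_option (R : Type) (idx : R) (op : Monoid.com_law idx) (T : finType)
    (F : option T -> R) :
  \big[op/idx]_u F u = op (F None) (\big[op/idx]_t F (Some t)).
Proof.
rewrite (bigD1 None) //=; congr (op _ _).
rewrite (reindex_omap Some id) /=; last by case.
by apply: eq_bigl => t; rewrite eqxx.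
Qed.

Lemma big_pair (R : Type) (idx : R) (op : Monoid.com_law idx) (I J : finType)
    (F : I * J -> R) :
  \big[op/idx]_p F p = \big[op/idx]_i \big[op/idx]_j F (i, j).
Proof. by rewrite pair_bigA; apply: eq_bigr => -[]. Qed.

Section HubCliques.

Variable k : nat.

(* [None] is the hub; [Some (j, (b, i))] is a vertex of the j-th clique, adjacent
   to the hub iff [b]. *)
Definition hub_edge : rel (option ('I_(k.*2.-1) * (bool * 'I_k))) :=
  fun u v => match u, v with
  | Some (i, c), Some (j, d) => (i == j) && (c != d)
  | Some (_, c), None | None, Some (_, c) => c.1
  | None, None => false
  end.

Lemma hub_edge_sym : symmetric hub_edge.
Proof. by move=> [[i c]|] [[j d]|] //=; rewrite eq_sym [c == d]eq_sym. Qed.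

Lemma hub_edge_irrefl : irreflexive hub_edge.
Proof. by move=> [[i c]|] //=; rewrite !eqxx. Qed.

Definition hub_cliques : sgraph := SGraph hub_edge_sym hub_edge_irrefl.

Variable l : hub_cliques -> nat.

Let nsum (v : hub_cliques) := \sum_(w in neighbors v) l w.

(** All other vertices of the clique are neighbours, so adding the vertex's own label completes the
    clique sum. Stated additively, this avoids truncated subtraction. *)
Lemma nsum_clique j c :
  nsum (Some (j, c)) + l (Some (j, c)) =
  c.1 * l None + \sum_d l (Some (j, d)).
Proof.
rewrite /nsum (eq_bigl (hub_edge (Some (j, c)))); last by move=> w; rewrite inE.
rewrite big_mkcond big_option /= mulnbl -addnA; congr (_ + _).
rewrite big_pair /=.
rewrite (bigD1 j) //= [X in _ + X + _]big1 ?addn0 => [|i ij]; last first.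
  by apply: big1 => d _; rewrite eq_sym (negPf ij).
rewrite [RHS](bigD1 c) //= addnC; congr (_ + _).
by rewrite -big_mkcond; apply: eq_bigl => d; rewrite eqxx eq_sym.
Qed.

Lemma nsum_hub : nsum None = \sum_j \sum_i l (Some (j, (true, i))).
Proof.
rewrite /nsum (eq_bigl (hub_edge None)); last by move=> w; rewrite inE.
rewrite big_mkcond big_option /= add0n big_pair.
by apply: eq_bigr => j _; rewrite big_pair big_bool /= [X in _ + X]big1 ?addn0.
Qed.

End HubCliques.

Lemma hub_cliques_labelable k : 0 < k -> additively_labelable (hub_cliques k) k.
Proof.
move=> k_gt0.
(* Both halves of a clique carry [1..k]; subtracting the hub label [k] moves the half adjacent to
   the hub to [1-k..0], disjoint from the other half. *)
pose l (v : hub_cliques k) := if v is Some (_, (_, i)) then (val i).+1 else k.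
have lk v : 1 <= l v <= k by case: v => [[j [b i]]|] /=; rewrite ?k_gt0 /=.
exists l => //; split=> [v|]; first by have /andP[] := lk v.
pose A := \sum_(i < k) i.+1.
have kA : k <= A.
  by rewrite /A; case: (k) k_gt0 => // m _; rewrite big_ord_recr leq_addl.
have SE j (c : bool * 'I_k) :
    \sum_(w in neighbors (Some (j, c) : hub_cliques k)) l w + c.2.+1 = c.1 * k + (A + A).
  case: c => b i; have /= -> := nsum_clique _ l j (b, i).
  by rewrite big_pair big_bool.
have HE : \sum_(w in neighbors (None : hub_cliques k)) l w = k.*2.-1 * A.
  by rewrite nsum_hub /= sum_nat_const card_ord.
have hub_clique j (c : bool * 'I_k) : c.1 ->
    \sum_(w in neighbors (Some (j, c) : hub_cliques k)) l w <>
    \sum_(w in neighbors (None : hub_cliques k)) l w.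
  case: c => b i /= bT; have := SE j (b, i); rewrite HE bT /= => + E.
  (* The clique vertex has sum [k + 2 * A - i.+1], which is at least [2 * A] and below [3 * A]. A
     single clique gives the hub only [A]; three or more give it at least [3 * A]. *)
  rewrite E; have := ltn_ord i; have [k_le1|k_gt1] := leqP k 1.
    have -> : k.*2.-1 = 1 by lia.
    lia.
  have : 3 * A <= k.*2.-1 * A by rewrite leq_mul2r; lia.
  lia.
move=> [[j c]|] [[j' d]|] //=; last 2 first.
- by move=> /(hub_clique j) H /esym.
- exact: hub_clique.
case/andP=> /eqP <- cd E; case/eqP: cd.
have := SE j c; have := SE j d; rewrite E.
case: c d {E} => [b i] [b' i'] /=; move: (ltn_ord i) (ltn_ord i').
by case: b b' => [] [] *; try lia; congr (_, _); apply: val_inj => /=; lia.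
Qed.

Lemma hub_cliques_not_choosable k m :
  m < k.*2 -> ~ additively_choosable (hub_cliques k) m.
Proof.
move=> mk.
(* Indices start at 0, so clique [j] is aimed at the hub label [j.+1]: its shifted list is [1..m]
   moved up by [j.+1]. *)
pose L (v : hub_cliques k) :=
  if v is Some (j, (true, _)) then iota j.+2 m else iota 1 m.
case/(_ L) => [v|l [_ lP] lL].
  by split; case: v => [[j [[] i]]|];
     rewrite ?iota_uniq ?size_iota //; apply/allP => a; rewrite mem_iota; lia.
have := lL None; rewrite mem_iota => lx.
(* The hub label is at most [m], hence at most [2k - 1], so some clique is aimed at it. *)
have [j jE] : exists j : 'I_(k.*2.-1), l None = j.+1.
  have jk : (l None).-1 < k.*2.-1 by lia.
  by exists (Ordinal jk); apply/esym/prednK; case/andP: lx.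
(* Labels next to the hub are at least [j.+2], so this subtraction never truncates. *)
pose f (c : bool * 'I_k) := l (Some (j, c)) - c.1 * j.+1.
have fL c : 0 < f c <= m /\ l (Some (j, c)) = f c + c.1 * j.+1.
  rewrite /f; case: c => b i; have := lL (Some (j, (b, i))).
  by case: b; rewrite /= mem_iota; move: (l _) => a; lia.
have : ~ injective f.
  move=> f_inj.
  have /uniq_leq_size H : uniq (map f (enum {: bool * 'I_k})).
    by rewrite map_inj_uniq ?enum_uniq.
  have /H : {subset map f (enum {: bool * 'I_k}) <= iota 1 m}.
    by move=> _ /mapP[c _ ->]; rewrite mem_iota; have [] := fL c; lia.
  by rewrite size_map -cardE card_prod card_bool card_ord size_iota; lia.
apply=> c d fcd; apply/eqP/negP => /negP cd.
have /lP : edge (Some (j, c) : hub_cliques k) (Some (j, d)) by rewrite /= eqxx.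
(* Once the hub term cancels, each neighbour sum plus the common value [f d] is the clique total. *)
apply; apply: (@addIn (f d)).
have := nsum_clique _ l j d; rewrite jE (fL d).2 addnA addnC => /addnI ->.
by have := nsum_clique _ l j c; rewrite jE (fL c).2 fcd addnA addnC => /addnI ->.
Qed.

Theorem theorem1 (k : nat) (hk : 0 < k) :
  exists G : sgraph,
    additive_number G <= k /\
    (k%:R <= (additive_choosability G)%:R / 2 :> rat)%R.
Proof.
exists (hub_cliques k); split.
  rewrite /additive_number; case: ex_minnP => n _; apply.
  exact/asboolP/hub_cliques_labelable.
rewrite /additive_choosability; case: ex_minnP => n /asboolP ch _.
rewrite Num.Theory.ler_pdivlMr // -GRing.natrM Num.Theory.ler_nat muln2 leqNgt.
by apply/negP => /hub_cliques_not_choosable.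
Qed.
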